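(* For any given $x,\delta\in\mathbb{N}$, one can determine in $O(nmx^2+m\log m)$ time whether a given route $R$ in a temporal graph $\mathcal{G}$ is $x$-delay-robust, where $n$ is the number of vertices of $R$ and $m$ is the number of time arcs connecting consecutive vertices of $R$.
   Context: A temporal graph $\mathcal{G}=(V,E)$ consists of a finite vertex set $V$ and a finite set $E$ of time arcs $e=(v,w,t,\lambda)$ with start vertex $v$, end vertex $w$, time label $t\in\mathbb{N}$ and traversal time $\lambda\in\mathbb{N}$. A temporal walk is a sequence of time arcs $(v_i,w_i,t_i,\lambda_i)_{i=1}^{\ell}$ with $v_{i+1}=w_i$ and $t_{i+1}\ge t_i+\lambda_i$ for all $i<\ell$. For $D\subseteq E$ and $\delta\in\mathbb{N}$, a $D$-traversal-delayed temporal walk is a temporal walk in the temporal graph obtained from $\mathcal{G}$ by increasing the traversal time of every arc of $D$ by $\delta$ (starting-delayed walks are defined analogously by increasing time labels instead; the resulting notion of robustness is the same for both delay types). A route is a sequence of vertices $R$; a delayed temporal walk follows $R$ if the vertices it visits ($v_1,w_1,\dots,w_\ell$) are exactly $R$ in order. $R$ is $x$-delay-robust if for every $D\subseteq E$ with $|D|\le x$ some $D$-delayed temporal walk follows $R$. *)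

(* Defs.v *)
From mathcomp Require Import all_boot finmap.

Set Implicit Arguments.
Unset Strict Implicit.
Unset Printing Implicit Defensive.

Local Open Scope fset_scope.
Local Open Scope nat_scope.

Section TemporalGraphs.
Variable V : finType.

(* A time arc (v, w, t, lambda): tail, head, time label, traversal time. *)
Definition arc : Type := (V * V * nat * nat)%type.
Definition src (e : arc) : V := e.1.1.1.
Definition dst (e : arc) : V := e.1.1.2.
Definition label (e : arc) : nat := e.1.2.
Definition trav (e : arc) : nat := e.2.

Definition tgraph : Type := {fset (V * V * nat * nat)}.

Definition compatible (e f : arc) : bool :=
  (src f == dst e) && (label e + trav e <= label f).

Definition temporal_walk (E : tgraph) (p : seq arc) : bool :=
  all [in E] p && sorted compatible p.

(* The walk without arcs stays at a single vertex. *)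
Definition follows (p : seq arc) (R : seq V) : bool :=
  if p is e :: _ then R == src e :: map dst p else size R == 1.

Definition delay_arc (D : tgraph) (delta : nat) (e : arc) : arc :=
  if e \in D then (src e, dst e, label e, trav e + delta) else e.

Definition traversal_delayed (E D : tgraph) (delta : nat) : tgraph :=
  [fset delay_arc D delta e | e in E].

Definition delay_robust (E : tgraph) (x delta : nat) (R : seq V) : Prop :=
  forall D : tgraph, D `<=` E -> #|` D| <= x ->
  exists p : seq arc,
    temporal_walk (traversal_delayed E D delta) p /\ follows p R.

Definition route_arcs (E : tgraph) (R : seq V) : tgraph :=
  [fset e in E | (src e, dst e) \in zip R (behead R)].

End TemporalGraphs.

(* Computation model: a random-access machine over natural numbers, with     *)
(* finitely many registers and finitely many unbounded arrays used by each   *)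
(* program, addition, truncated subtraction and comparison (no               *)
(* multiplication), every elementary operation having unit cost.             *)

Inductive expr : Type :=
| Cst of nat
| Reg of nat
| Get of nat & expr
| Add of expr & expr
| Sub of expr & expr.

Inductive test : Type := Lt of expr & expr.

Inductive prog : Type :=
| Skip
| Assign of nat & expr
| Store of nat & expr & expr
| Seq of prog & prog
| If of test & prog & prog
| While of test & prog.

Record state : Type := State {
  regs : nat -> nat;
  arrs : nat -> nat -> nat
}.

Fixpoint eval (s : state) (e : expr) : nat :=
  match e with
  | Cst c => c
  | Reg r => regs s r
  | Get a e1 => arrs s a (eval s e1)
  | Add e1 e2 => eval s e1 + eval s e2
  | Sub e1 e2 => eval s e1 - eval s e2
  end.

Fixpoint cost (e : expr) : nat :=
  match e with
  | Cst _ | Reg _ => 1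
  | Get _ e1 => (cost e1).+1
  | Add e1 e2 | Sub e1 e2 => (cost e1 + cost e2).+1
  end.

Definition eval_test (s : state) (t : test) : bool :=
  let: Lt e1 e2 := t in eval s e1 < eval s e2.

Definition cost_test (t : test) : nat :=
  let: Lt e1 e2 := t in (cost e1 + cost e2).+1.

Definition set_reg (s : state) (r c : nat) : state :=
  State (fun q => if q == r then c else regs s q) (arrs s).

Definition set_arr (s : state) (a i c : nat) : state :=
  State (regs s)
    (fun b j => if (b == a) && (j == i) then c else arrs s b j).

(* [exec p s k s']: from [s], the program [p] halts in [s'] after [k] steps. *)
Inductive exec : prog -> state -> nat -> state -> Prop :=
| exec_Skip s : exec Skip s 1 s
| exec_Assign r e s : exec (Assign r e) s (cost e).+1 (set_reg s r (eval s e))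
| exec_Store a e1 e2 s :
    exec (Store a e1 e2) s (cost e1 + cost e2).+1
      (set_arr s a (eval s e1) (eval s e2))
| exec_Seq p1 p2 s1 s2 s3 k1 k2 :
    exec p1 s1 k1 s2 -> exec p2 s2 k2 s3 ->
    exec (Seq p1 p2) s1 (k1 + k2) s3
| exec_If t p1 p2 s k s' :
    exec (if eval_test s t then p1 else p2) s k s' ->
    exec (If t p1 p2) s (cost_test t + k) s'
| exec_WhileF t p s :
    ~~ eval_test s t -> exec (While t p) s (cost_test t) s
| exec_WhileT t p s1 s2 s3 k1 k2 :
    eval_test s1 t -> exec p s1 k1 s2 -> exec (While t p) s2 k2 s3 ->
    exec (While t p) s1 (cost_test t + k1 + k2) s3.

Lemma exec_det p s k1 s1 k2 s2 :
  exec p s k1 s1 -> exec p s k2 s2 -> k1 = k2 /\ s1 = s2.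
Proof.
move=> H1; elim: H1 k2 s2 => {p s k1 s1}.
- by move=> s k2 s2 H; inversion H.
- by move=> r e s k2 s2 H; inversion H.
- by move=> a e1 e2 s k2 s2 H; inversion H.
- move=> p1 p2 s1 s2 s3 k1 k2 _ IH1 _ IH2 k s H; inversion H; subst.
  match goal with H1 : exec p1 _ _ _ |- _ => have [<- E] := IH1 _ _ H1 end.
  by subst; match goal with H2 : exec p2 _ _ _ |- _ => have [<- <-] := IH2 _ _ H2 end.
- move=> t p1 p2 s k s' _ IH k2 s2 H; inversion H; subst.
  by match goal with H1 : exec _ s _ s2 |- _ => have [<- <-] := IH _ _ H1 end.
- move=> t p s Nt k2 s2 H; inversion H; subst=> //.
  by match goal with H1 : is_true (eval_test s t) |- _ => rewrite H1 in Nt end.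
- move=> t p s1 s2 s3 k1 k2 Ht _ IH1 _ IH2 k s H; inversion H; subst.
    by match goal with H1 : is_true (~~ _) |- _ => rewrite Ht in H1 end.
  match goal with H1 : exec p _ _ _ |- _ => have [<- E] := IH1 _ _ H1 end.
  by subst; match goal with H2 : exec (While t p) _ _ s |- _ => have [<- <-] := IH2 _ _ H2 end.
Qed.

Definition code (V : finType) (v : V) : nat := enum_rank v.

(* The graph is stored as a matrix of arc lists: array 1 holds row offsets,  *)
(* the cell of the pair (v, w) gives in arrays 2 and 3 the start and the     *)
(* length of the list of the time arcs from v to w, in arbitrary order, whose *)
(* labels and traversal times are in arrays 4 and 5.                         *)
Definition stores_graph (V : finType) (E : tgraph V) (s : state) : Prop :=
  forall v w : V,
    let c := arrs s 1 (code v) + code w in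
    perm_eq
      [seq (v, w, arrs s 4 j, arrs s 5 j) | j <- iota (arrs s 2 c) (arrs s 3 c)]
      [seq e <- E | (src e == v) && (dst e == w)].

(* Registers and array cells not mentioned here have arbitrary contents.     *)
Definition stores_instance (V : finType) (E : tgraph V) (R : seq V)
    (x delta : nat) (s : state) : Prop :=
  [/\ regs s 0 = size R, regs s 1 = x, regs s 2 = delta,
      mkseq (arrs s 0) (size R) = map (@code V) R
    & stores_graph E s].

(* The value of an O-expression at an instance. A parameter equal to 0 counts *)
(* as 1 in the polynomial term: the algorithm has to inspect the route even   *)
(* when x = 0 or m = 0.                                                       *)
Definition time_bound (n m x : nat) : nat :=
  maxn 1 n * maxn 1 m * maxn 1 x ^ 2 + m * trunc_log 2 m.

(* Main.v *)
(* An adversary spends x delays so as to strand a walker who follows R. Along R,  *)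
(* let A(i, q) be the worst earliest arrival at the i-th vertex when q delays     *)
(* have been spent; then A(i + 1, j) is the maximum over q <= j of the arrival    *)
(* forced by j - q delays on arcs to the next vertex from time A(i, q), namely    *)
(* min(a_1 + delta, a_(j-q+1)), a_1 <= a_2 <= ... being the undelayed arrivals of *)
(* the arcs labelled A(i, q) or later. R is robust iff such an arc exists for all *)
(* i and q. For fixed i and q, the values a_1, a_2, ... come from at most x + 1   *)
(* linear scans of the unsorted arc list, each finding the next distinct arrival, *)
(* which gives O(n m x^2) without the m log m preprocessing.                      *)

Require Import Defs.
From mathcomp Require Import all_boot finmap.
From mathcomp Require Import zify.

Set Implicit Arguments.
Unset Strict Implicit.
Unset Printing Implicit Defensive.

Local Open Scope fset_scope.
Local Open Scope nat_scope.

(** * The dynamic program *)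

(** The game between adversary and walker decomposes along the route for two reasons. Time only
    moves forward: at time T only arcs labelled T or later matter ([feasible_future]), so the delays
    useful in one step never act again and the budget splits step by step ([breakable_cons]). And
    lateness never helps the walker ([feasible_le], [feasible_sub]), so for each amount already
    spent it suffices to remember the worst arrival ([breakable_step]).

    In a single step, d delays can force an arrival at t or later exactly when at most d arcs arrive
    before t and each of these, once delayed, arrives at t or later. [delayed_arrival_spec] shows
    that [delayed_arrival] is the largest such t. [delay_robustP] identifies the game with the
    delayed walks following the route.

    For the running time, each route step treats x + 1 budgets, each with O(x + 1) scans of one arc
    list. The triples [runs] carry result and cost together, up to [decide_runs]. *)

Lemma foldl_minn_spec (c : nat) (s : seq nat) :
  foldl minn c s \in c :: s /\ all (leq (foldl minn c s)) (c :: s).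
Proof.
elim/last_ind: s => [|s y [IH1 IH2]]; first by rewrite /= inE eqxx leqnn.
rewrite foldl_rcons -rcons_cons mem_rcons all_rcons geq_minr /=.
have /= -> : all (leq (minn (foldl minn c s) y)) (c :: s).
  by apply: sub_all IH2 => z; apply: leq_trans; exact: geq_minl.
split=> //; rewrite /minn; case: ifP => _; last by rewrite inE eqxx.
by rewrite inE IH1 orbT.
Qed.

(** * The worst arrival over a single step *)

Section StepValue.
Variables (delta T : nat) (L : seq (nat * nat)).

Definition arrivals : seq nat := [seq e.2 | e <- L & T <= e.1].

(* Shifted by one, so that 0 signals that no arc is available. *)
Definition earliest (s : seq nat) : nat :=
  if s is y :: s' then (foldl minn y s').+1 else 0.

Definition next_arrival (top c : nat) : nat :=
  foldl minn top [seq y <- arrivals | c < y].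

Definition first_delayed : nat := (earliest arrivals).-1 + delta.

(* The min of [first_delayed] and the (d+1)-st smallest arrival: against a walker *)
(* at time T, d delays are best spent on the d earliest arrivals.                *)
Fixpoint delayed_arrival (d : nat) : nat :=
  if d is d'.+1 then
    let c := delayed_arrival d' in
    if count (geq c) arrivals < d.+1 then next_arrival first_delayed c else c
  else (earliest arrivals).-1.

Lemma earliest_spec : arrivals != [::] ->
  (earliest arrivals).-1 \in arrivals /\
  all (leq (earliest arrivals).-1) arrivals.
Proof. by case: arrivals => //= y s _; apply: foldl_minn_spec. Qed.

(** The clauses pin the value down as the largest threshold up to [first_delayed] with at most d
    arrivals strictly below it. As d grows by one, the threshold moves to the next distinct arrival
    if the arrivals up to the current one fit in the budget; otherwise ties hold it in place. *)
Lemma delayed_arrival_spec d : arrivals != [::] ->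
  [/\ delayed_arrival d <= first_delayed,
      count (gtn (delayed_arrival d)) arrivals <= d
    & forall t, t <= first_delayed -> count (gtn t) arrivals <= d ->
        t <= delayed_arrival d].
Proof.
move=> ne; have [ain /allP amin] := earliest_spec ne.
elim: d => [|d [IH1 IH2 IH3]] /=.
  split; first exact: leq_addr.
    rewrite leqn0 -[_ == 0]negbK -lt0n -has_count; apply/hasPn => y /amin /=.
    by rewrite -leqNgt.
  move=> t _; rewrite leqn0 -[_ == 0]negbK -lt0n -has_count => /hasPn/(_ _ ain).
  by rewrite /= -leqNgt.
set c := delayed_arrival d in IH1 IH2 IH3 *.
have le_count (p q : pred nat) : (forall y, p y -> q y) ->
    count p arrivals <= count q arrivals by move=> ?; apply: sub_count.
case: ifP => Hc.
  have [nin /allP nmin] := foldl_minn_spec first_delayed [seq y <- arrivals | c < y].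
  rewrite -/(next_arrival first_delayed c) in nin nmin *.
  split; first by apply: nmin; rewrite inE eqxx.
    (* No arrival lies strictly between c and the new value, so the arrivals below the latter are
       among those up to c. *)
    apply: (@leq_trans (count (geq c) arrivals)); last exact: Hc.
    elim: arrivals {ne ain amin IH2 IH3 le_count Hc nin} nmin => //= y s IHs nm.
    have nm' : {in first_delayed :: [seq y <- s | c < y], forall z, next_arrival first_delayed c <= z}.
      move=> z; rewrite inE => /orP[/eqP->|zin]; first by apply: nm; rewrite inE eqxx.
      by apply: nm; rewrite inE; case: ifP => _; rewrite ?inE zin !orbT.
    apply: leq_add; last exact: IHs.
    case: (ltnP c y) => //= Hy; last by case: (_ < _).
    have := nm y; rewrite Hy !inE eqxx orbT => /(_ isT).
    by rewrite ltnNge => ->.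
  move=> t tc; apply: contraTT; rewrite -!ltnNge => nt.
  move: nin; rewrite inE => /orP[/eqP nc|]; first by move: nt; rewrite nc ltnNge tc.
  rewrite mem_filter => /andP[cn nin].
  (* By maximality of c, the threshold c + 1 already exceeds the old budget d; the next arrival adds
     one more, so no later threshold is affordable. *)
  have h1 : d < count (geq c) arrivals.
    rewrite ltnNge; apply/negP => h.
    by have := IH3 c.+1 (leq_trans (ltn_trans cn nt) tc) h; rewrite ltnn.
  apply: leq_ltn_trans h1 _.
  have := count_predUI (geq c) (pred1 (next_arrival first_delayed c)) arrivals.
  have -> : count (predI (geq c) (pred1 (next_arrival first_delayed c))) arrivals = 0.
    rewrite -[RHS](count_pred0 arrivals); apply: eq_count => y /=.
    by apply/negP => /andP[h /eqP h2]; rewrite h2 leqNgt cn in h.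
  rewrite addn0 => E.
  apply: (@leq_trans (count (predU (geq c) (pred1 (next_arrival first_delayed c))) arrivals)).
    rewrite E -[X in X < _]addn0 ltn_add2l -has_count; apply/hasP.
    by exists (next_arrival first_delayed c) => /=.
  apply: le_count => y /= /orP[h|/eqP-> //].
  by apply: leq_ltn_trans h (ltn_trans cn nt).
split=> //; first exact: leqW.
move=> t tc; apply: contraTT; rewrite -!ltnNge => ct.
move/negbT: Hc; rewrite -leqNgt => /leq_trans; apply.
by apply: le_count => y /= h; apply: leq_ltn_trans h ct.
Qed.

Lemma delayed_arrival_bound d y :
  y \in arrivals -> delayed_arrival d <= y + delta.
Proof.
move=> yin; have ne : arrivals != [::] by apply: contraTneq yin => ->.
have [le_cap _ _] := delayed_arrival_spec d ne.
apply: leq_trans le_cap _; rewrite leq_add2r.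
by have [_ /allP/(_ _ yin)] := earliest_spec ne.
Qed.

Lemma delayed_arrival_max d t : arrivals != [::] ->
  {in arrivals, forall y, t <= y + delta} ->
  count (gtn t) arrivals <= d -> t <= delayed_arrival d.
Proof.
move=> ne Ht Hc; have [_ _] := delayed_arrival_spec d ne; apply=> //.
by apply: Ht; have [] := earliest_spec ne.
Qed.

Lemma earliest_eq0 : (earliest arrivals == 0) = (arrivals == [::]).
Proof. by case: arrivals. Qed.

End StepValue.

(** * The delay game along a route *)

Section Robustness.
Variables (V : finType) (E : tgraph V) (delta : nat).
Local Notation arc := (Defs.arc V).

Definition delayed_end (D : tgraph V) (e : arc) : nat :=
  label e + trav e + (if e \in D then delta else 0).

Fixpoint feasible (D : tgraph V) (T : nat) (Ls : seq (seq arc)) : bool :=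
  if Ls is L :: Ls' then
    has (fun e => (T <= label e) && feasible D (delayed_end D e) Ls') L
  else true.

Definition breakable (T j : nat) (Ls : seq (seq arc)) : Prop :=
  exists D : tgraph V, [/\ D `<=` E, #|` D| <= j & ~~ feasible D T Ls].

Definition timing (e : arc) : nat * nat := (label e, label e + trav e).

Lemma feasible_le D T T' Ls : T <= T' -> feasible D T' Ls -> feasible D T Ls.
Proof.
case: Ls => //= L Ls le_T; apply: sub_has => e /andP[h ->].
by rewrite (leq_trans le_T h).
Qed.

Lemma feasible_sub (D D' : tgraph V) T Ls :
  D' `<=` D -> feasible D T Ls -> feasible D' T Ls.
Proof.
move=> sD; elim: Ls T => //= L Ls IH T; apply: sub_has => e /andP[-> h] /=.
apply: IH; apply: feasible_le h; rewrite /delayed_end leq_add2l.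
by case: ifP => // /(fsubsetP sD) ->.
Qed.

Lemma feasible_future (D D' : tgraph V) T Ls :
  (forall e, T <= label e -> (e \in D) = (e \in D')) ->
  feasible D T Ls = feasible D' T Ls.
Proof.
elim: Ls T => //= L Ls IH T HD; apply: eq_has => e.
case: leqP => //= Te; rewrite /delayed_end HD //; apply: IH => f hf; apply: HD.
by apply: leq_trans Te _; apply: leq_trans hf; rewrite -addnA leq_addr.
Qed.

Lemma breakable_le T T' j j' Ls :
  T <= T' -> j <= j' -> breakable T j Ls -> breakable T' j' Ls.
Proof.
move=> lT lj [D [sD cD nD]]; exists D; split=> //; first exact: leq_trans cD lj.
by apply: contra nD; apply: feasible_le.
Qed.

Lemma arrivals_timing T (L : seq arc) :
  arrivals T (map timing L) = [seq label e + trav e | e <- L & T <= label e].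
Proof. by rewrite /arrivals filter_map -map_comp. Qed.

(* The useful delays of one step hit arcs with label >= T that would arrive     *)
(* before the walker does; by [feasible_future] they are never met again, so the *)
(* budgets of the steps add up even when R repeats a pair of vertices.           *)
Lemma breakable_cons T j L Ls : uniq L -> {subset L <= E} ->
  breakable T j (L :: Ls) <->
  arrivals T (map timing L) = [::] \/
  exists2 d, d <= j &
    breakable (delayed_arrival delta T (map timing L) d) (j - d) Ls.
Proof.
move=> uL sL; set A := arrivals T _.
have inA e : e \in L -> T <= label e -> label e + trav e \in A.
  by move=> eL Te; rewrite /A arrivals_timing; apply/mapP; exists e; rewrite ?mem_filter ?Te.
split=> [[D [sD cD /= nD]]|[A0|[d dj [D [sD cD nD]]]]].
- have [A0|ne] := eqVneq A [::]; first by left.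
  right.
  pose F := [seq delayed_end D e | e <- L & T <= label e].
  have neF : F != [::] by move: ne; rewrite /A arrivals_timing /F; case: filter.
  (* The earliest time at which the walker can finish this step under D. *)
  pose t := (earliest F).-1.
  have [tF /allP tmin] : t \in F /\ all (leq t) F.
    by rewrite /t; case: (F) neF => //= y s _; apply: foldl_minn_spec.
  (* The delays that act in this step; their number is the witness d. Their labels lie below t, so
     removing them from D leaves the game from time t on unchanged. *)
  pose D1 := [fset e in D | [&& e \in L, T <= label e & label e + trav e < t]].
  have sD1 : D1 `<=` D by apply/fsubsetP => e; rewrite !inE => /andP[].
  exists #|` D1|; first by apply: leq_trans cD; apply: fsubset_leq_card.
  apply: (@breakable_le t _ (j - #|` D1|)) => //; last first.
    exists (D `\` D1); split; first by apply: fsubset_trans sD; apply: fsubsetDl.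
      by rewrite cardfsDS // leq_sub2r.
    apply: contra nD; rewrite (@feasible_future _ D); last first.
      move=> e te; rewrite !inE; case: (e \in D); rewrite ?andbF //= andbT.
      apply/negP => /and3P[_ _ h]; move: te; rewrite leqNgt => /negP; apply.
      by apply: leq_ltn_trans h; apply: leq_addr.
    case/mapP: tF => e; rewrite mem_filter => /andP[Te eL] -> h.
    by apply/hasP; exists e => //; rewrite Te.
  have tle e : e \in L -> T <= label e -> t <= delayed_end D e.
    by move=> eL Te; apply: tmin; apply: map_f; rewrite mem_filter Te.
  apply: delayed_arrival_max => //.
    move=> y; rewrite arrivals_timing => /mapP[e].
    rewrite mem_filter => /andP[Te eL] ->; apply: leq_trans (tle _ eL Te) _.
    by rewrite leq_add2l; case: ifP.
  (* An available arc with undelayed arrival before t must be in D, since t is the earliest arrival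
     under D; hence it is in D1. *)
  rewrite -/A /A arrivals_timing count_map -size_filter -filter_predI.
  apply: uniq_leq_size; first by rewrite filter_uniq.
  move=> e; rewrite mem_filter /= => /andP[/andP[h Te] eL].
  rewrite !inE eL Te h /= andbT.
  have := tle _ eL Te; rewrite /delayed_end; case: ifP => // _.
  by rewrite addn0 leqNgt h.
- exists fset0; split; rewrite ?fsub0set ?cardfs0 //=.
  apply/hasPn => e eL; apply/negP => /andP[Te _].
  by have := inA _ eL Te; rewrite A0.
set f := delayed_arrival _ _ _ _ in nD.
pose s := [seq e <- L | (T <= label e) && (label e + trav e < f)].
(* With no available arc, f is only a default value, but the walker is stuck without any delay. *)
have [A0|ne] := eqVneq A [::].
  exists fset0; split; rewrite ?fsub0set ?cardfs0 //=.
  apply/hasPn => e eL; apply/negP => /andP[Te _].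
  by have := inA _ eL Te; rewrite A0.
have [_ cf _] := delayed_arrival_spec delta d ne.
(* Delay also the arcs that would arrive before f: there are at most d of them, and
   [delayed_arrival_bound] puts their delayed arrivals at f or later. *)
exists (D `|` [fset e in s]); split.
- rewrite fsubUset sD; apply/fsubsetP => e; rewrite inE /s mem_filter => /andP[_].
  exact: sL.
- apply: leq_trans (leq_card_fsetU _ _) _.
  rewrite -(subnK dj); apply: leq_add => //.
  have -> : #|` [fset e in s]| = size s.
    by rewrite card_fseq undup_id ?filter_uniq.
  apply: leq_trans cf; rewrite -/f arrivals_timing count_map -size_filter.
  rewrite -filter_predI; apply: eq_leq; congr size; apply: eq_filter => e /=.
  by rewrite andbC.
apply: contra nD => /= /hasP[e eL /andP[Te h]].
apply: (@feasible_sub (D `|` [fset e in s])); first exact: fsubsetUl.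
apply: feasible_le h; rewrite /delayed_end.
case: (ltnP (label e + trav e) f) => hf; last exact: leq_trans hf (leq_addr _ _).
rewrite !inE /= /s mem_filter Te hf eL orbT.
exact: delayed_arrival_bound (inA _ eL Te).
Qed.

Lemma breakable_nil T j : ~ breakable T j [::].
Proof. by case=> D [_ _]. Qed.

(** The parameter p cuts the maximum to budgets below p, so that it can serve as a loop invariant; p
    = x + 1 gives the full recurrence for j up to x. *)
Definition worst_arrival (L : seq (nat * nat)) (A : nat -> nat) (p j : nat) :=
  \max_(q < p | q <= j) delayed_arrival delta (A q) L (j - q).

(** All budgets advance together. The maximum over q is attained, and spending j - q delays from
    there leaves x - j; conversely, monotonicity ([breakable_le]) lets the maximum replace any
    single q. *)
Lemma breakable_step (A : nat -> nat) x L Ls : uniq L -> {subset L <= E} ->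
  (forall q, q <= x -> ~ breakable (A q) (x - q) (L :: Ls)) <->
  (forall q, q <= x -> arrivals (A q) (map timing L) != [::]) /\
  (forall j, j <= x ->
     ~ breakable (worst_arrival (map timing L) A x.+1 j) (x - j) Ls).
Proof.
move=> uL sL; split=> [H|[H1 H2] q qx /(breakable_cons _ _ _ uL sL)[]].
- split=> [q qx|j jx].
    by apply/eqP => A0; apply: (H q qx); apply/breakable_cons => //; left.
  have [q qj Eq] : {q : 'I_x.+1 | q <= j & worst_arrival (map timing L) A x.+1 j =
      delayed_arrival delta (A q) (map timing L) (j - q)}.
    by apply: eq_bigmax_cond; apply/card_gt0P; exists ord0.
  rewrite Eq => B; apply: (H q); first by rewrite -ltnS.
  apply/breakable_cons => //; right; exists (j - q); first exact: leq_sub2r.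
  by have -> : x - q - (j - q) = x - j by lia.
- by move=> A0; have := H1 q qx; rewrite A0.
case=> d dj B; have dq : q + d <= x by lia.
apply: (H2 (q + d) dq); apply: breakable_le B; last by rewrite subnDA.
rewrite -ltnS in qx; have := leq_addr d q.
move=> /(@leq_bigmax_cond _ (fun i : 'I_x.+1 => i <= q + d)
  (fun i : 'I_x.+1 => delayed_arrival delta (A i) (map timing L) (q + d - i))
  (Ordinal qx)).
by rewrite /= addKn.
Qed.

(** * Delayed walks as plays of the game *)

Lemma delay_arcE D e : [/\ src (delay_arc D delta e) = src e,
  dst (delay_arc D delta e) = dst e, label (delay_arc D delta e) = label e
  & label e + trav (delay_arc D delta e) = delayed_end D e].
Proof. by rewrite /delay_arc /delayed_end; case: ifP; rewrite ?addn0 ?addnA. Qed.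

Variable cell : V -> V -> seq arc.
Hypothesis cellP :
  forall v w, perm_eq (cell v w) [seq e <- E | (src e == v) && (dst e == w)].

Definition route_cells (R : seq V) : seq (seq arc) :=
  [seq cell p.1 p.2 | p <- zip R (behead R)].

Lemma mem_cell v w e : e \in cell v w = [&& src e == v, dst e == w & e \in E].
Proof. by rewrite (perm_mem (cellP v w)) mem_filter andbA. Qed.

(** Delaying may make two arcs coincide; this is harmless, as only existence of a walk counts and
    any preimage of a delayed arc has the right ends and arrival. *)
Lemma feasibleP D T v R :
  feasible D T (route_cells (v :: R)) <->
  exists p, [/\ all [in traversal_delayed E D delta] p, sorted (@compatible V) p,
    map (@dst V) p = R & if p is e :: _ then src e = v /\ T <= label e else True].
Proof.
elim: R v T => [|w R IH] v T; first by split=> // _; exists [::].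
have -> : route_cells [:: v, w & R] = cell v w :: route_cells (w :: R) by [].
rewrite /=; split=> [/hasP[e]|[p]].
  rewrite mem_cell => /and3P[/eqP sv /eqP dw eE] /= /andP[Te /IH[p [pE sp pR hp]]].
  have [s1 s2 s3 s4] := delay_arcE D e.
  exists (delay_arc D delta e :: p); split=> /=.
  - by rewrite pE andbT; apply: in_imfset.
  - case: p hp sp {pE pR} => //= f p [sf lf] ->.
    by rewrite /compatible sf s2 dw eqxx s3 s4 lf.
  - by rewrite s2 dw pR.
  by rewrite s1 s3.
case: p => [[]|e p [/andP[eE pE] sp [dw pR] [sv Te]]] //.
case/imfsetP: eE => f /= fE ef; have [s1 s2 s3 s4] := delay_arcE D f.
apply/hasP; exists f.
  by rewrite mem_cell fE andbT -s1 -s2 -ef sv dw !eqxx.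
rewrite -s3 -ef Te; apply/IH; exists p; split=> //; first exact: path_sorted sp.
case: p sp {pE pR} => //= g p /andP[/andP[/eqP sg lg] _]; split; first by rewrite sg.
by rewrite -s4 -s3 -ef.
Qed.

Lemma delay_robustP x v R :
  delay_robust E x delta (v :: R) <->
  ~ breakable 0 x (route_cells (v :: R)).
Proof.
have walkP D : (exists p, temporal_walk (traversal_delayed E D delta) p /\
    follows p (v :: R)) <-> feasible D 0 (route_cells (v :: R)).
  rewrite feasibleP; split=> [[p [/andP[pE sp] fp]]|[p [pE sp pR hp]]].
    exists p; split=> //; case: (p) fp => [|e q] /=; rewrite ?eqSS ?size_eq0.
    - by move/eqP->.
    - by case/eqP => _ ->.
    - by [].
    - by case/eqP => ->.
  exists p; rewrite /temporal_walk pE sp; split=> //.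
  case: p {pE sp} pR hp => [<- //|e q /= <- [-> _] //].
split=> [H [D [sD cD /negP]]|H D sD cD]; first by apply; apply/walkP; apply: H.
by apply/walkP/negPn/negP => nf; apply: H; exists D.
Qed.

End Robustness.

(** * Running times of programs *)

Definition runs (p : prog) (s : state) (b : nat) (Q : state -> Prop) : Prop :=
  exists k s', [/\ exec p s k s', k <= b & Q s'].

(** The remaining program is the postcondition of the first part, so code is verified front to back
    without stating intermediate assertions. *)
Lemma runs_seq p1 p2 s b1 b2 Q :
  runs p1 s b1 (fun s' => runs p2 s' b2 Q) -> runs (Seq p1 p2) s (b1 + b2) Q.
Proof.
case=> k1 [s1 [e1 h1 [k2 [s2 [e2 h2 q]]]]]; exists (k1 + k2), s2.
by split=> //; [apply: exec_Seq e1 e2 | apply: leq_add].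
Qed.

Lemma runs_if t p1 p2 s b Q :
  runs (if eval_test s t then p1 else p2) s b Q ->
  runs (If t p1 p2) s (cost_test t + b) Q.
Proof.
case=> k [s' [e h q]]; exists (cost_test t + k), s'; rewrite leq_add2l.
by split=> //; apply: exec_If.
Qed.

Lemma runs_sub p s b b' (Q Q' : state -> Prop) :
  b <= b' -> (forall s', Q s' -> Q' s') -> runs p s b Q -> runs p s b' Q'.
Proof.
move=> hb hQ [k [s' [e h q]]]; exists k, s'.
by split=> //; [apply: leq_trans hb | apply: hQ].
Qed.

(** The invariant is indexed by the completed rounds and decides the test; induction on the rounds
    left gives termination and cost at once. *)
Lemma runs_while t p b N (I : nat -> state -> Prop) s :
  (forall i s, i <= N -> I i s -> eval_test s t = (i < N)) ->
  (forall i s, i < N -> I i s -> runs p s b (I i.+1)) ->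
  I 0 s -> runs (While t p) s (N * (cost_test t + b) + cost_test t) (I N).
Proof.
move=> Ht Hp; rewrite -[X in runs _ _ (X * _ + _)]subn0.
have: 0 <= N by []; move: 0 => i; move En: (N - i) => n.
elim: n i s En => [|n IH] i s En iN Ii.
  have Ei : i = N by lia.
  rewrite Ei in Ii; exists (cost_test t), s; split; rewrite ?leq_addl //.
  by apply: exec_WhileF; rewrite (Ht N) // ltnn.
have lt_iN : i < N by lia.
have [k1 [s1 [e1 h1 I1]]] := Hp _ _ lt_iN Ii.
have En1 : N - i.+1 = n by lia.
have [k2 [s2 [e2 h2 I2]]] := IH _ _ En1 lt_iN I1.
exists (cost_test t + k1 + k2), s2; split=> //; last by nia.
by apply: exec_WhileT e1 e2; rewrite (Ht i).
Qed.

Fixpoint loopfree (p : prog) : bool :=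
  match p with
  | Seq p1 p2 | If _ p1 p2 => loopfree p1 && loopfree p2
  | While _ _ => false
  | _ => true
  end.

Fixpoint run (p : prog) (s : state) : state :=
  match p with
  | Assign r e => set_reg s r (eval s e)
  | Store a e1 e2 => set_arr s a (eval s e1) (eval s e2)
  | Seq p1 p2 => run p2 (run p1 s)
  | If t p1 p2 => if eval_test s t then run p1 s else run p2 s
  | _ => s
  end.

Fixpoint max_cost (p : prog) : nat :=
  match p with
  | Skip => 1
  | Assign _ e => (cost e).+1
  | Store _ e1 e2 => (cost e1 + cost e2).+1
  | Seq p1 p2 => max_cost p1 + max_cost p2
  | If t p1 p2 => cost_test t + maxn (max_cost p1) (max_cost p2)
  | While _ _ => 0
  end.

(** Reduces loop-free code to computation of its final state and worst-case cost; the values of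
    [run] and [max_cost] at [While] are dummies. *)
Lemma runs_loopfree p s b (Q : state -> Prop) :
  loopfree p -> max_cost p <= b -> Q (run p s) -> runs p s b Q.
Proof.
move=> lp hb hQ; suff [k e hk] : exists2 k, exec p s k (run p s) & k <= max_cost p.
  by exists k, (run p s); split=> //; apply: leq_trans hb.
elim: p s lp {b Q hb hQ} => /= [|r e|a e1 e2|p1 IH1 p2 IH2|t p1 IH1 p2 IH2|//] s.
- by exists 1 => //; constructor.
- by exists (cost e).+1 => //; constructor.
- by exists (cost e1 + cost e2).+1 => //; constructor.
- case/andP=> l1 l2; have [k1 e1 h1] := IH1 s l1.
  have [k2 e2 h2] := IH2 (run p1 s) l2; exists (k1 + k2); last exact: leq_add.
  exact: exec_Seq e1 e2.
case/andP=> l1 l2; have [k1 e1 h1] := IH1 s l1; have [k2 e2 h2] := IH2 s l2.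
exists (cost_test t + if eval_test s t then k1 else k2).
  by apply: exec_If; case: ifP.
by rewrite leq_add2l; case: ifP => _; rewrite leq_max ?h1 ?h2 ?orbT.
Qed.

Definition frame (rs ars : seq nat) (s s' : state) : Prop :=
  (forall r, r \notin rs -> regs s' r = regs s r) /\
  (forall a j, a \notin ars -> arrs s' a j = arrs s a j).

Lemma frame_refl rs ars s : frame rs ars s s.
Proof. by []. Qed.

Lemma frame_trans rs ars rs1 ars1 rs2 ars2 s1 s2 s3 :
  {subset rs1 <= rs} -> {subset ars1 <= ars} ->
  {subset rs2 <= rs} -> {subset ars2 <= ars} ->
  frame rs1 ars1 s1 s2 -> frame rs2 ars2 s2 s3 -> frame rs ars s1 s3.
Proof.
move=> sr1 sa1 sr2 sa2 [r1 a1] [r2 a2]; split=> [r hr|a j ha].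
  by rewrite r2 ?r1 //; [apply: contra (sr1 r) hr | apply: contra (sr2 r) hr].
by rewrite a2 ?a1 //; [apply: contra (sa1 a) ha | apply: contra (sa2 a) ha].
Qed.

Lemma frame_set_reg rs ars s s' r c :
  r \in rs -> frame rs ars s s' -> frame rs ars s (set_reg s' r c).
Proof.
move=> hr [h1 h2]; split=> // q hq /=; case: eqP => [E|_]; last exact: h1.
by rewrite E hr in hq.
Qed.

Lemma frame_set_arr rs ars s s' a i c :
  a \in ars -> frame rs ars s s' -> frame rs ars s (set_arr s' a i c).
Proof.
move=> ha [h1 h2]; split=> // b j hb /=; case: eqP => [E|_]; last exact: h2.
by rewrite E ha in hb.
Qed.

Ltac frame_solve :=
  repeat first [apply: frame_set_reg; first by []
               | apply: frame_set_arr; first by []]; by [].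

(** * The algorithm *)

Definition timings (s : state) (st len : nat) : seq (nat * nat) :=
  [seq (arrs s 4 j, arrs s 4 j + arrs s 5 j) | j <- iota st len].

Lemma timingsS s st len : timings s st len.+1 =
  rcons (timings s st len)
    (arrs s 4 (st + len), arrs s 4 (st + len) + arrs s 5 (st + len)).
Proof. by rewrite /timings -(addn1 len) iotaD map_cat cats1. Qed.

Lemma timings_frame rs ars s s' st len : 4 \notin ars -> 5 \notin ars ->
  frame rs ars s s' -> timings s' st len = timings s st len.
Proof. by move=> h4 h5 [_ h]; apply: eq_map => j; rewrite !h. Qed.

Lemma arrivals_rcons T L e : arrivals T (rcons L e) =
  if T <= e.1 then rcons (arrivals T L) e.2 else arrivals T L.
Proof. by rewrite /arrivals filter_rcons; case: ifP; rewrite ?map_rcons. Qed.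

(** The update made when a scan meets one more available arc; its case split is that of
    [earliest_body]. *)
Lemma earliest_rcons s y : earliest (rcons s y) =
  if earliest s < 1 then y.+1 else minn (earliest s) y.+1.
Proof. by case: s => //= z s; rewrite foldl_rcons minnSS. Qed.

(* Memory: r3 position on the route, r4 fill index, r5 success flag, r6 cell,    *)
(* r7 and r8 bounds of its arc list, r9 budget q spent before the step, r10 time *)
(* T, r11 [earliest], r12 arc index, r13 [delayed_arrival d], r14                *)
(* [first_delayed], r15 budget d of the step, r16 count and r17 minimum of       *)
(* [scan_next]; array 6 worst arrivals at the current vertex, indexed by budget, *)
(* array 7 those at the next one.                                                *)
Definition arrival : expr := Add (Get 4 (Reg 12)) (Get 5 (Reg 12)).

Definition incr (r : nat) : prog := Assign r (Add (Reg r) (Cst 1)).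

(** * Scans of one arc list *)

Definition earliest_body : prog :=
  Seq (If (Lt (Get 4 (Reg 12)) (Reg 10)) Skip
        (If (Lt (Reg 11) (Cst 1)) (Assign 11 (Add arrival (Cst 1)))
          (If (Lt (Add arrival (Cst 1)) (Reg 11))
            (Assign 11 (Add arrival (Cst 1))) Skip)))
      (incr 12).

Definition scan_earliest : prog :=
  Seq (Seq (Assign 11 (Cst 0)) (Assign 12 (Reg 7)))
      (While (Lt (Reg 12) (Reg 8)) earliest_body).

Lemma scan_earliest_runs s len M :
  regs s 8 = regs s 7 + len -> len <= M -> 0 < M ->
  runs scan_earliest s (100 * M) (fun s' =>
    frame [:: 11; 12] [::] s s' /\
    regs s' 11 = earliest (arrivals (regs s 10) (timings s (regs s 7) len))).
Proof.
move=> Hlen lenM M0.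
pose I t s' := [/\ frame [:: 11; 12] [::] s s', regs s' 12 = regs s 7 + t
  & regs s' 11 = earliest (arrivals (regs s 10) (timings s (regs s 7) t))].
(* Initialisation costs at most 5, each test 3, each body at most 50; 0 < M absorbs the constants
   when the list is empty. *)
apply: (@runs_sub _ _ (5 + (len * (3 + 50) + 3)) _ (I len)); first lia.
  by move=> s' [].
apply: runs_seq; apply: runs_loopfree => //=; apply: runs_while.
- by move=> i s' _ [[Fr Fa] E1 E2] /=; rewrite E1 Fr // Hlen ltn_add2l.
- move=> i s' lt_i [F E1 E2]; have [Fr Fa] := F; apply: runs_loopfree => //=.
  rewrite /I timingsS arrivals_rcons /= E1 E2 !Fa // !Fr //.
  case: leqP => _ /=; last by rewrite E1 E2; split; [frame_solve | lia |].
  rewrite earliest_rcons; case: ltnP => _ /=.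
    by rewrite E1 !addn1; split; [frame_solve | lia |].
  by rewrite minnC /minn !addn1; case: ltnP => _ /=; rewrite E1 ?E2;
     split=> //; [frame_solve | lia | frame_solve | lia].
by rewrite /I /= addn0; split=> //; frame_solve.
Qed.

Definition next_body : prog :=
  Seq (If (Lt (Get 4 (Reg 12)) (Reg 10)) Skip
        (If (Lt (Reg 13) arrival)
          (If (Lt arrival (Reg 17)) (Assign 17 arrival) Skip)
          (incr 16)))
      (incr 12).

Definition scan_next : prog :=
  Seq (Seq (Assign 16 (Cst 0)) (Seq (Assign 17 (Reg 14)) (Assign 12 (Reg 7))))
      (While (Lt (Reg 12) (Reg 8)) next_body).

Lemma scan_next_runs s len M :
  regs s 8 = regs s 7 + len -> len <= M -> 0 < M ->
  runs scan_next s (100 * M) (fun s' =>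
    let ys := arrivals (regs s 10) (timings s (regs s 7) len) in
    [/\ frame [:: 12; 16; 17] [::] s s', regs s' 16 = count (geq (regs s 13)) ys
      & regs s' 17 = foldl minn (regs s 14) [seq y <- ys | regs s 13 < y]]).
Proof.
move=> Hlen lenM M0.
pose I t s' := let ys := arrivals (regs s 10) (timings s (regs s 7) t) in
  [/\ frame [:: 12; 16; 17] [::] s s', regs s' 12 = regs s 7 + t,
    regs s' 16 = count (geq (regs s 13)) ys
  & regs s' 17 = foldl minn (regs s 14) [seq y <- ys | regs s 13 < y]].
apply: (@runs_sub _ _ (7 + (len * (3 + 50) + 3)) _ (I len)); first lia.
  by move=> s' [].
apply: runs_seq; apply: runs_loopfree => //=; apply: runs_while.
- by move=> i s' _ [[Fr Fa] E1 E2 E3] /=; rewrite E1 Fr // Hlen ltn_add2l.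
- move=> i s' lt_i [F E1 E2 E3]; have [Fr Fa] := F; apply: runs_loopfree => //=.
  rewrite /I timingsS arrivals_rcons /= E1 E2 E3 !Fa // !Fr //.
  case: leqP => _ /=; last by rewrite E1 E2 E3; split; [frame_solve | lia | |].
  rewrite filter_rcons -cats1 count_cat /= addn0; case: ltnP => _ /=.
    rewrite foldl_rcons minnC /minn addn0.
    by case: ltnP => _ /=; rewrite E1 ?E2 ?E3; split=> //; first [frame_solve | lia].
  by rewrite E1 E3; split=> //; first [frame_solve | lia].
by rewrite /I /= addn0; split=> //; frame_solve.
Qed.

(** * Loops over budgets *)

Definition spread_body : prog :=
  Seq (Seq (If (Lt (Get 7 (Add (Reg 9) (Reg 15))) (Reg 13))
             (Store 7 (Add (Reg 9) (Reg 15)) (Reg 13)) Skip)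
           (incr 15))
      (Seq scan_next
           (If (Lt (Reg 16) (Add (Reg 15) (Cst 1))) (Assign 13 (Reg 17)) Skip)).

Definition spread : prog :=
  While (Lt (Add (Reg 9) (Reg 15)) (Add (Reg 1) (Cst 1))) spread_body.

Lemma spread_runs s len M delta :
  let T := regs s 10 in
  let L := timings s (regs s 7) len in
  regs s 8 = regs s 7 + len -> len <= M -> 0 < M ->
  regs s 13 = (earliest (arrivals T L)).-1 -> regs s 14 = first_delayed delta T L ->
  regs s 15 = 0 -> regs s 9 <= regs s 1 ->
  runs spread s (200 * M * (regs s 1).+1) (fun s' =>
    frame [:: 12; 13; 15; 16; 17] [:: 7] s s' /\
    forall j, arrs s' 7 j = if regs s 9 <= j <= regs s 1
      then maxn (arrs s 7 j) (delayed_arrival delta T L (j - regs s 9))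
      else arrs s 7 j).
Proof.
move=> T L Hlen lenM M0 Hc Hcap Hd qx; set q := regs s 9; set x := regs s 1.
pose I d s' := [/\ frame [:: 12; 13; 15; 16; 17] [:: 7] s s', regs s' 15 = d,
  regs s' 13 = delayed_arrival delta T L d
  & forall j, arrs s' 7 j = if q <= j < q + d
      then maxn (arrs s 7 j) (delayed_arrival delta T L (j - q))
      else arrs s 7 j].
apply: (@runs_sub _ _ ((x.+1 - q) * (7 + (60 + 100 * M)) + 7) _ (I (x.+1 - q))).
- by nia.
- move=> s' [F _ _ HB]; split=> // j; rewrite HB; congr (if _ then _ else _); lia.
apply: runs_while.
- by move=> i s' _ [[Fr Fa] E1 E2 E3] /=; rewrite E1 !Fr // -/q -/x; lia.
- move=> d s' lt_d [F E1 E2 E3]; have [Fr Fa] := F.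
  apply: (@runs_sub _ _ (40 + (100 * M + 20))); [lia | by move=> s'' Hs''; exact: Hs'' |].
  apply: runs_seq; apply: runs_loopfree => //=.
  set s1 := set_reg _ _ _.
  have [F1 R1 R2 B1] : [/\ frame [:: 12; 13; 15; 16; 17] [:: 7] s s1,
      regs s1 15 = d.+1, regs s1 13 = delayed_arrival delta T L d
      & forall j, arrs s1 7 j = if q <= j < q + d.+1
        then maxn (arrs s 7 j) (delayed_arrival delta T L (j - q))
        else arrs s 7 j].
    rewrite /s1 E1 E2 E3 Fr // -/q ltnn andbF; case: ltnP => h /=.
    - rewrite E1 E2 addn1; split=> //; first frame_solve.
      move=> j; case: eqP => [->|jq]; first by rewrite addKn; case: ifP; lia.
      by rewrite E3; congr (if _ then _ else _); lia.
    rewrite E1 E2 addn1; split=> //; first frame_solve.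
    move=> j; rewrite E3; case: (eqVneq j (q + d)) => [->|jq].
      by rewrite addKn; do 2![case: ifP]; lia.
    by congr (if _ then _ else _); lia.
  move: (s1) F1 R1 R2 B1 => {}s1 F1 R1 R2 B1; have [Fr1 Fa1] := F1.
  apply: runs_seq; apply: runs_sub (leqnn _) _ (@scan_next_runs s1 len M _ lenM M0);
    last by rewrite !Fr1.
  (* The counter was raised before the scan, so the machine test is the one in [delayed_arrival] at
     the new budget d + 1. *)
  move=> s2 /= [F2 R3 R4]; apply: runs_loopfree => //=.
  have [Fr2 Fa2] := F2.
  have F3 : frame [:: 12; 13; 15; 16; 17] [:: 7] s s2.
    by apply: frame_trans F1 F2 => // r; rewrite !inE => /or3P[] /eqP->.
  have L1 : timings s1 (regs s1 7) len = L.
    by rewrite Fr1 //; apply: timings_frame F1.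
  move: R3 R4; rewrite L1 (Fr1 10) // (Fr1 14) // R2 Hcap -/T => R3 R4.
  rewrite R3 R4 (Fr2 15) // R1 addn1.
  case: ltnP => h; split=> /=; try by [rewrite (Fr2 15) | move=> j; rewrite Fa2].
  - frame_solve.
  - by rewrite ifT.
  - exact: F3.
  by rewrite (Fr2 13) // R2 ifF // ltnNge h.
split=> //= j; rewrite addn0; case: ifP => //; lia.
Qed.

Lemma worst_arrivalS delta L A p j : worst_arrival delta L A p.+1 j =
  if p <= j then maxn (worst_arrival delta L A p j)
                      (delayed_arrival delta (A p) L (j - p))
  else worst_arrival delta L A p j.
Proof.
by rewrite /worst_arrival big_mkcond big_ord_recr -big_mkcond /=; case: ifP; rewrite ?maxn0.
Qed.

Definition budget_body : prog :=
  Seq (Assign 10 (Get 6 (Reg 9)))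
    (Seq scan_earliest
      (Seq (Seq (If (Lt (Reg 11) (Cst 1)) (Assign 5 (Cst 0)) Skip)
             (Seq (Assign 13 (Defs.Sub (Reg 11) (Cst 1)))
               (Seq (Assign 14 (Add (Reg 13) (Reg 2))) (Assign 15 (Cst 0)))))
        (Seq spread (incr 9)))).

Definition budgets : prog :=
  Seq (Assign 9 (Cst 0)) (While (Lt (Reg 9) (Add (Reg 1) (Cst 1))) budget_body).

Definition budget_regs : seq nat := [:: 5; 9; 10; 11; 12; 13; 14; 15; 16; 17].

(** When no arc is available the flag drops to 0 and the loop goes on with default values. Truncated
    subtraction agrees with the predecessor at 0, so array 7 is described unconditionally. *)
Lemma budgets_runs s len M :
  let x := regs s 1 in
  let L := timings s (regs s 7) len in
  regs s 8 = regs s 7 + len -> len <= M -> 0 < M ->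
  (forall j, j <= x -> arrs s 7 j = 0) ->
  runs budgets s (400 * M * x.+1 ^ 2) (fun s' =>
    [/\ frame budget_regs [:: 7] s s',
        regs s' 5 = 1 <->
          regs s 5 = 1 /\ forall q, q <= x -> arrivals (arrs s 6 q) L != [::]
      & forall j, j <= x ->
          arrs s' 7 j = worst_arrival (regs s 2) L (arrs s 6) x.+1 j]).
Proof.
move=> x L Hlen lenM M0 H7.
pose I p s' := [/\ frame budget_regs [:: 7] s s', regs s' 9 = p,
  regs s' 5 = 1 <->
    regs s 5 = 1 /\ forall q, q < p -> arrivals (arrs s 6 q) L != [::]
  & forall j, j <= x -> arrs s' 7 j = worst_arrival (regs s 2) L (arrs s 6) p j].
apply: (@runs_sub _ _ (2 + (x.+1 *
  (5 + (3 + (100 * M + (30 + (200 * M * x.+1 + 4))))) + 5)) _ (I x.+1)).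
- by nia.
- by move=> s' [].
apply: runs_seq; apply: runs_loopfree => //; apply: runs_while; last first.
- split=> /=; [frame_solve | by [] | by split=> [->|[]] |].
  by move=> j jx; rewrite H7 // /worst_arrival big_ord0.
- move=> p s' lt_p [F E1 E2 E3]; have [Fr Fa] := F.
  apply: runs_seq; apply: runs_loopfree => //=; rewrite E1 Fa //.
  set s1 := set_reg _ _ _.
  have F1 : frame budget_regs [:: 7] s s1 by frame_solve.
  have R1 : [/\ regs s1 9 = p, regs s1 10 = arrs s 6 p, regs s1 5 = regs s' 5
    & forall j, arrs s1 7 j = arrs s' 7 j] by split.
  move: (s1) F1 R1 => {}s1 F1 [R9 R10 R5 R7]; have [Fr1 Fa1] := F1.
  have L1 : timings s1 (regs s1 7) len = L by rewrite Fr1 //; apply: timings_frame F1.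
  apply: runs_seq; apply: runs_sub (leqnn _) _ (@scan_earliest_runs s1 len M _ lenM M0);
    last by rewrite !Fr1.
  move=> s2 [F2]; rewrite L1 R10 => R11; have [Fr2 Fa2] := F2.
  have F12 : frame budget_regs [:: 7] s s2.
    by apply: frame_trans F1 F2 => // r; rewrite !inE => /orP[] /eqP->.
  have [Fr12 Fa12] := F12.
  apply: runs_seq; apply: runs_loopfree => //=; set s3 := set_reg _ _ _.
  have [F3 Q] : frame budget_regs [:: 7] s s3 /\
    [/\ regs s3 9 = p, regs s3 10 = arrs s 6 p,
      regs s3 5 = 1 <-> regs s 5 = 1 /\
        forall q, q < p.+1 -> arrivals (arrs s 6 q) L != [::],
      forall j, arrs s3 7 j = arrs s' 7 j
      & [/\ regs s3 13 = (earliest (arrivals (arrs s 6 p) L)).-1,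
            regs s3 14 = first_delayed (regs s 2) (arrs s 6 p) L & regs s3 15 = 0]].
    have Hp : (forall q, q < p.+1 -> arrivals (arrs s 6 q) L != [::]) <->
       (forall q, q < p -> arrivals (arrs s 6 q) L != [::]) /\
       arrivals (arrs s 6 p) L != [::].
      split=> [H|[H1 H2] q]; first by split=> [q qp|]; apply: H; lia.
      by rewrite ltnS leq_eqVlt => /orP[/eqP->|/H1].
    rewrite /s3 R11 ltnS leqn0 earliest_eq0; case: eqP => A0 /=.
      rewrite R11 (Fr12 2) // subn1; split; first frame_solve.
      split=> //; rewrite ?Fr2 //; last by move=> j; rewrite Fa2.
      by split=> // -[_ /Hp[_]]; rewrite A0.
    rewrite R11 (Fr12 2) // subn1; split; first frame_solve.
    split=> //; rewrite ?Fr2 //; last by move=> j; rewrite Fa2.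
    by rewrite R5 E2 Hp; split=> [[? ?]|[? [? _]]] //; split=> //; split=> //; apply/eqP.
  move: (s3) F3 Q => {}s3 F3 [S9 S10 S5 S7 [S13 S14 S15]]; have [Fr3 Fa3] := F3.
  have L3 : timings s3 (regs s3 7) len = L by rewrite Fr3 //; apply: timings_frame F3.
  have Ex : regs s3 1 = x by rewrite Fr3.
  have := @spread_runs s3 len M (regs s 2); rewrite /= L3 S9 S10 Ex.
  rewrite !(Fr3 7) // !(Fr3 8) // => W.
  apply: runs_seq; apply: runs_sub (leqnn _) _ (W _ lenM M0 S13 S14 S15 _) => //.
  move=> s4 [F4 B4]; have [Fr4 Fa4] := F4; apply: runs_loopfree => //=.
  have F34 : frame budget_regs [:: 7] s s4.
    by apply: frame_trans F3 F4 => // r; rewrite !inE => /or4P[||| /orP[]] /eqP->.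
  split=> /=; [frame_solve | by rewrite Fr4 // S9 addn1 | by rewrite Fr4 |].
  move=> j jx; rewrite B4 jx andbT worst_arrivalS S7 E3 //.
by move=> p s' _ [[Fr Fa] E1 _ _] /=; rewrite E1 Fr // -/x addn1.
Qed.

Definition fill (a : nat) (e : expr) : prog :=
  Seq (Assign 4 (Cst 0))
    (While (Lt (Reg 4) (Add (Reg 1) (Cst 1))) (Seq (Store a (Reg 4) e) (incr 4))).

(** Serves both to clear an array and to copy one; the frame hypothesis keeps the value of [e]
    independent of the array being overwritten. *)
Lemma fill_runs s a e (v : nat -> nat) :
  cost e <= 2 ->
  (forall s', frame [:: 4] [:: a] s s' -> eval s' e = v (regs s' 4)) ->
  runs (fill a e) s (30 * (regs s 1).+1) (fun s' =>
    frame [:: 4] [:: a] s s' /\ forall j, j <= regs s 1 -> arrs s' a j = v j).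
Proof.
move=> ce He; set x := regs s 1.
pose I i s' := [/\ frame [:: 4] [:: a] s s', regs s' 4 = i
  & forall j, j < i -> arrs s' a j = v j].
apply: (@runs_sub _ _ (2 + (x.+1 * (5 + 10) + 5)) _ (I x.+1)); first lia.
  by move=> s' [].
have aa : a \in [:: a] by rewrite inE.
apply: runs_seq; apply: runs_loopfree => //; apply: runs_while.
- by move=> i s' _ [[Fr Fa] E1 _] /=; rewrite E1 Fr // -/x addn1.
- move=> i s' _ [F E1 E2]; apply: runs_loopfree => //=; first lia.
  split=> /=; last 2 first.
  + by rewrite E1 addn1.
  + move=> j; rewrite eqxx E1 He // E1 /= ltnS leq_eqVlt.
    by case: eqP => [-> //|_ /= /E2].
  by apply: frame_set_reg => //; apply: frame_set_arr.
by split=> //=; apply: frame_set_reg.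
Qed.

Definition locate : prog :=
  Seq (Assign 6 (Add (Get 1 (Get 0 (Reg 3))) (Get 0 (Add (Reg 3) (Cst 1)))))
    (Seq (Assign 7 (Get 2 (Reg 6))) (Assign 8 (Add (Reg 7) (Get 3 (Reg 6))))).

Definition step : prog :=
  Seq locate
    (Seq (fill 7 (Cst 0))
      (Seq budgets (Seq (fill 6 (Get 7 (Reg 4))) (incr 3)))).

Definition step_regs : seq nat := [:: 3; 4; 6; 7; 8] ++ budget_regs.

Lemma step_runs s M :
  let x := regs s 1 in
  let i := regs s 3 in
  let c := arrs s 1 (arrs s 0 i) + arrs s 0 i.+1 in
  let L := timings s (arrs s 2 c) (arrs s 3 c) in
  arrs s 3 c <= M -> 0 < M ->
  runs step s (600 * M * x.+1 ^ 2) (fun s' =>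
    [/\ frame step_regs [:: 6; 7] s s', regs s' 3 = i.+1,
        regs s' 5 = 1 <->
          regs s 5 = 1 /\ forall q, q <= x -> arrivals (arrs s 6 q) L != [::]
      & forall j, j <= x ->
          arrs s' 6 j = worst_arrival (regs s 2) L (arrs s 6) x.+1 j]).
Proof.
move=> x i c L lenM M0.
apply: (@runs_sub _ _ (20 + (30 * x.+1 + (400 * M * x.+1 ^ 2 + (30 * x.+1 + 10))))).
- by nia.
- by move=> s' H; exact: H.
apply: runs_seq; apply: runs_loopfree => //=; rewrite addn1 -/i -/c.
set s1 := set_reg _ _ _.
have F1 : frame step_regs [:: 6; 7] s s1 by frame_solve.
have R1 : [/\ regs s1 5 = regs s 5, regs s1 3 = i, regs s1 7 = arrs s 2 c
  & regs s1 8 = arrs s 2 c + arrs s 3 c] by split.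
have A1 a j : arrs s1 a j = arrs s a j by [].
move: (s1) F1 R1 A1 => {}s1 F1 [R5 R3 R7 R8] A1; have [Fr1 Fa1] := F1.
have x1 : regs s1 1 = x by rewrite Fr1.
apply: runs_seq; rewrite -{1}x1.
apply: runs_sub (leqnn _) _ (@fill_runs s1 7 (Cst 0) (fun=> 0) _ _) => //.
move=> s2 [F2]; rewrite x1 => Z2; have [Fr2 Fa2] := F2.
have x2 : regs s2 1 = x by rewrite Fr2.
have L2 : timings s2 (regs s2 7) (arrs s 3 c) = L.
  by rewrite Fr2 // R7; apply: eq_map => j; rewrite !Fa2 // !A1.
have := @budgets_runs s2 (arrs s 3 c) M.
rewrite /= x2 L2 !Fr2 // R7 R8 => /(_ erefl lenM M0 Z2) W.
apply: runs_seq; apply: runs_sub (leqnn _) _ W => s3 [F3 S5 S7].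
have [Fr3 Fa3] := F3.
have x3 : regs s3 1 = x by rewrite Fr3.
have A6 q : arrs s2 6 q = arrs s 6 q by rewrite Fa2.
apply: runs_seq; rewrite -{1}x3.
apply: runs_sub (leqnn _) _ (@fill_runs s3 6 (Get 7 (Reg 4)) (arrs s3 7) _ _) => //.
  move=> s4 [F4]; rewrite x3 => B4; have [Fr4 Fa4] := F4; apply: runs_loopfree => //=.
  split=> /=.
  - have F12 : frame step_regs [:: 6; 7] s s2.
      by apply: frame_trans F1 F2 => // r; rewrite inE => /eqP->.
    have F13 : frame step_regs [:: 6; 7] s s3.
      apply: frame_trans F12 F3 => // r; last by rewrite inE => /eqP->.
      by move=> h; rewrite mem_cat h orbT.
    apply: frame_set_reg => //.
    by apply: frame_trans F13 F4 => // r; rewrite inE => /eqP->.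
  - by rewrite Fr4 // Fr3 // Fr2 // R3 addn1.
  - rewrite Fr4 // S5 R5.
    by split=> -[h1 h2]; split=> // q qx; move: (h2 q qx); rewrite A6.
  move=> j jx; rewrite B4 // S7 // (Fr1 2) //; apply: eq_bigr => q _.
  by rewrite A6.
by move=> s' [_ Fa]; rewrite /= Fa.
Qed.

(** * The complete decision procedure *)

Definition decide : prog :=
  If (Lt (Reg 0) (Cst 1)) Skip
    (Seq (fill 6 (Cst 0))
      (Seq (Seq (Assign 3 (Cst 0)) (Assign 5 (Cst 1)))
        (Seq (While (Lt (Add (Reg 3) (Cst 1)) (Reg 0)) step) (Assign 0 (Reg 5))))).

Definition stored_cell (V : finType) (s : state) (v w : V) : seq (Defs.arc V) :=
  let c := arrs s 1 (code v) + code w in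
  [seq (v, w, arrs s 4 j, arrs s 5 j) | j <- iota (arrs s 2 c) (arrs s 3 c)].

Lemma map_timing_stored_cell (V : finType) s (v w : V) :
  let c := arrs s 1 (code v) + code w in
  map (@timing V) (stored_cell s v w) = timings s (arrs s 2 c) (arrs s 3 c).
Proof. by rewrite /= -map_comp. Qed.

(** Bounds every scanned list by m. Each route step is charged m separately, as a route may repeat a
    pair of vertices. *)
Lemma size_cell_route (V : finType) (E : tgraph V) (R : seq V) v w cvw :
  perm_eq cvw [seq e <- E | (src e == v) && (dst e == w)] ->
  (v, w) \in zip R (behead R) -> size cvw <= #|` route_arcs E R|.
Proof.
move=> Hc vw; rewrite (perm_size Hc); apply: uniq_leq_size.
  by rewrite filter_uniq // fset_uniq.
move=> e; rewrite mem_filter => /andP[/andP[/eqP sv /eqP dw] eE].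
by rewrite !inE eE sv dw.
Qed.

Lemma delay_robust_nil (V : finType) (E : tgraph V) x delta :
  ~ delay_robust E x delta [::].
Proof. by move=> /(_ fset0 (fsub0set _))[|[|e p] [_]] //; rewrite cardfs0. Qed.

Lemma decide_runs (V : finType) (E : tgraph V) (R : seq V) x delta s :
  stores_instance E R x delta s ->
  runs decide s
    (5 + (30 * x.+1 + (5 + ((size R).-1 *
      (5 + 600 * maxn 1 #|` route_arcs E R| * x.+1 ^ 2) + 10))))
    (fun s' => regs s' 0 = 1 <-> delay_robust E x delta R).
Proof.
case=> r0 r1 r2 aR gE; set M := maxn _ _.
have M0 : 0 < M by rewrite leq_max.
case: R r0 aR @M M0 => [|v R] r0 aR M M0.
  apply: (@runs_sub _ _ (3 + 1));
    [exact: (@leq_trans 5 4 _ isT (leq_addr _ _)) | by move=> s' H; exact: H |].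
  (* On the empty route register 0 already holds 0, the right answer since no walk follows it. *)
  apply: runs_if; rewrite ifT; last by rewrite /= r0.
  by apply: runs_loopfree => //=; rewrite r0; split=> // /delay_robust_nil.
pose Ls := route_cells (stored_cell s) (v :: R).
have sLs : size Ls = size R by rewrite size_map size_zip /=; lia.
(* The flag records that no step so far was blocked; the worst arrivals in array 6 reduce robustness
   to the rest of the route. *)
pose I i s' := [/\ frame step_regs [:: 6; 7] s s', regs s' 3 = i
  & delay_robust E x delta (v :: R) <-> regs s' 5 = 1 /\
    forall q, q <= x -> ~ breakable E delta (arrs s' 6 q) (x - q) (drop i Ls)].
have code_route i : i <= size R -> arrs s 0 i = code (nth v (v :: R) i).
  move=> iR; have := congr1 (fun l => nth 0 l i) aR.
  by rewrite nth_mkseq // (nth_map v).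
have step_ok i s1 : i < size R -> I i s1 ->
    runs step s1 (600 * M * x.+1 ^ 2) (I i.+1).
  move=> iR [F1 R3 RI]; have [Fr1 Fa1] := F1.
  set a := nth v (v :: R) i; set b := nth v (v :: R) i.+1.
  set c := arrs s 1 (code a) + code b.
  have ab_zip : (a, b) \in zip (v :: R) R.
    have -> : (a, b) = nth (v, v) (zip (v :: R) R) i.
      by rewrite nth_zip_cond size_zip /= (minn_idPr _) // iR.
    by apply: mem_nth; rewrite size_zip /= (minn_idPr _).
  have Hc : perm_eq (stored_cell s a b) _ := gE a b.
  have uL : uniq (stored_cell s a b).
    by rewrite (perm_uniq Hc) filter_uniq // fset_uniq.
  have sL : {subset stored_cell s a b <= E}.
    by move=> e; rewrite (perm_mem Hc) mem_filter => /andP[].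
  have dropE : drop i Ls = stored_cell s a b :: drop i.+1 Ls.
    rewrite (drop_nth [::]) ?sLs //; congr (_ :: _).
    rewrite /Ls /route_cells (nth_map (v, v)) ?size_zip /=; last by lia.
    by rewrite nth_zip_cond size_zip /= (minn_idPr _) // iR.
  have Hsize : arrs s 3 c <= M.
    rewrite leq_max; apply/orP; right.
    by have := size_cell_route Hc ab_zip; rewrite size_map size_iota.
  have := @step_runs s1 M.
  rewrite /= R3 !(Fa1 0, Fa1 1) // (code_route i) ?(ltnW iR) // (code_route i.+1) //.
  rewrite -/a -/b -/c !(Fa1 2, Fa1 3) // (Fr1 1) // (Fr1 2) // r1 r2.
  rewrite (timings_frame _ _ _ _ F1) // -map_timing_stored_cell.
  move=> /(_ Hsize M0); apply: runs_sub => // s2 [F2 S3 S5 S6].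
  have [Fr2 Fa2] := F2; split=> //; first exact: frame_trans F1 F2.
  rewrite RI dropE; have -> := breakable_step delta (arrs s1 6) x (drop i.+1 Ls) uL sL.
  rewrite S5; split=> [[h1 [h2 h3]]|[[h1 h2] h3]]; split=> //.
    by move=> q qx; rewrite S6 //; apply: h3.
  by split=> // j jx; rewrite -S6 //; apply: h3.
have init s1 : frame [:: 4] [:: 6] s s1 ->
    (forall j, j <= x -> arrs s1 6 j = 0) ->
    I 0 (set_reg (set_reg s1 3 0) 5 1).
  move=> F1 Z1; split=> //=.
    do !apply: frame_set_reg => //.
    by apply: frame_trans F1 (frame_refl [::] [::] s1) => // r; rewrite inE => /eqP->.
  (* All start times are 0: q = 0 is the actual claim, and larger q only leave the adversary a
     smaller budget. *)
  rewrite drop0 (@delay_robustP _ _ _ (stored_cell s) gE); split=> [H|[_ H]].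
    split=> // q qx; rewrite Z1 // => B; apply: H.
    by apply: breakable_le B => //; apply: leq_subr.
  by have := H 0 isT; rewrite Z1 // subn0.
apply: (@runs_sub _ _ (3 + (30 * x.+1 + (5 + (size R *
  (5 + 600 * M * x.+1 ^ 2) + 5 + 2))))); [by rewrite /=; lia | by move=> s' H; exact: H |].
apply: runs_if; rewrite ifF; last by rewrite /= r0.
apply: runs_seq; rewrite -{1}r1.
apply: runs_sub (leqnn _) _ (@fill_runs s 6 (Cst 0) (fun=> 0) _ _) => //.
rewrite r1 => s1 [F1 Z1]; apply: runs_seq; apply: runs_loopfree => //=.
apply: runs_seq; apply: runs_sub (leqnn _) _ (@runs_while _ _ _ (size R) I _ _ _ _).
- move=> s2 [_ _ RI]; apply: runs_loopfree => //=; rewrite RI drop_oversize ?sLs //.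
  by split=> [->|[]] //; split=> // q _; apply: breakable_nil.
- by move=> i s2 _ [[Fr _] E3 _] /=; rewrite E3 Fr // r0 addn1.
- by move=> i s2 iR Ii; apply: step_ok.
exact: init.
Qed.

Theorem theorem5 :
  exists (p : prog) (C : nat),
  forall (V : finType) (E : tgraph V) (R : seq V) (x delta : nat) (s : state),
    stores_instance E R x delta s ->
    exists (k : nat) (s' : state),
      [/\ exec p s k s',
          regs s' 0 = 1 <-> delay_robust E x delta R
        & k <= C * time_bound (size R) #|` route_arcs E R| x].
Proof.
exists decide, 3000 => V E R x delta s /decide_runs[k [s' [e h q]]].
exists k, s'; split=> //; apply: leq_trans h _.
apply: (@leq_trans (3000 * (maxn 1 (size R) *
  (maxn 1 #|` route_arcs E R| * maxn 1 x ^ 2)))); last first.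
  by rewrite leq_mul2l /time_bound mulnA leq_addr orbT.
set M := maxn 1 #|` _|; set X := maxn 1 x; set n := maxn 1 _.
have M1 : 0 < M by rewrite leq_max.
have X1 : x.+1 <= 2 * X by rewrite /X; lia.
have X0 : 0 < X by rewrite leq_max.
have XM : x.+1 ^ 2 * M <= 4 * (M * X ^ 2).
  have -> : 4 * (M * X ^ 2) = (2 * X) ^ 2 * M by rewrite expnMn mulnCA mulnC -mulnA.
  by rewrite leq_mul2r leq_sqr X1 orbT.
have XP : X <= M * X ^ 2 by rewrite -[X in X <= _]mul1n leq_mul // -mulnn leq_pmulr.
have -> : 600 * M * x.+1 ^ 2 = 600 * (x.+1 ^ 2 * M) by rewrite -mulnA [M * _]mulnC.
move: XM XP; set P := M * _; set Y := _ * M => XM XP.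
(* Here 2405 = 5 + 600 * 4, the 4 coming from (x + 1)^2 <= 4 * X^2; the remaining 595 of the 3000
   pay for the set-up outside the loop. *)
have Hn : (size R).-1 * (5 + 600 * Y) <= n * (2405 * P).
  by apply: leq_mul; rewrite /n; lia.
have nP : P <= n * P by rewrite leq_pmull // leq_max.
have -> : 3000 * (n * P) = 595 * (n * P) + n * (2405 * P) by lia.
lia.
Qed.
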